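(* Let $\vec S$ be a universe of set separations of a set $V$ with the order function $|X,Y|_r=r(X)+r(Y)-r(V)$ for some non-negative non-decreasing submodular function $r:2^V\to\mathbb N$, let $k\in\mathbb N$, and let $\mathcal F$ be a family of stars, each a finite multiset of elements of $\vec S_k$, which is fixed under shifting. If there exists an $S_k$-tree over $\mathcal F$, then there exists an $\mathcal F$-lean $S_k$-tree over $\mathcal F$.
   Context: For a set $V$, $\mathrm{sep}(V)=\{(A,B):A\cup B=V\}$, ordered by $(A,B)\le(C,D)$ iff $A\subseteq C$ and $B\supseteq D$, with involution $(A,B)^*=(B,A)$. A set separation system is a subset of $\mathrm{sep}(V)$ closed under $*$; a universe of set separations is one closed also under $(A,B)\wedge(C,D)=(A\cap C,B\cup D)$ and $(A,B)\vee(C,D)=(A\cup C,B\cap D)$. Let $\vec S_k=\{(A,B)\in\vec S:|A,B|_r<k\}$. For $(A,B)\le(C,D)$ put $\lambda((A,B),(C,D))=\min\{|X,Y|_r:(X,Y)\in\vec S,(A,B)\le(X,Y)\le(C,D)\}$; $(X,Y)$ is linked to $(A,B)$ if $(A,B)\le(X,Y)$ and $|X,Y|_r=\lambda((A,B),(X,Y))$. A star is a finite multiset $\sigma$ of separations such that any two of its members (distinct as members of the multiset) $(A,B),(C,D)$ satisfy $(A,B)\le(D,C)$. For a set separation system $\vec R$, an $R$-tree is a pair $(T,\alpha)$ with $T$ a finite tree and $\alpha$ a map from the set $\vec E(T)$ of oriented edges $(x,y)$ of $T$ to $\vec R$ with $\alpha(y,x)=\alpha(x,y)^*$; an $S_k$-tree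 is an $R$-tree for $\vec R=\vec S_k$. For $t\in V(T)$ let $\vec F_t=\{(x,t)\in\vec E(T)\}$ and $\sigma_t=\alpha(\vec F_t)$ (as a multiset); $(T,\alpha)$ is tame if every $\sigma_t$ is a star, and over $\mathcal F$ if every $\sigma_t\in\mathcal F$. Oriented edges are ordered by $(x,y)\le(u,v)$ iff they are equal or $T$ contains a path whose vertex sequence begins $x,y$ and ends $u,v$ (with $y=u$ allowed). For $\vec e=(x,y)$, $T(\vec e)$ is the subtree consisting of the component of $T-x$ containing $y$ together with $x$ and the edge $xy$. Shift: given a tame $R$-tree $(T,\alpha)$, $\vec e\in\vec E(T)$ and a separation $(X,Y)\ge\alpha(\vec e)$, the shift of $(T,\alpha)$ onto $(X,Y)$ with respect to $\vec e$ is $(T(\vec e),\alpha')$ where for each edge $f$ of $T(\vec e)$, with $\vec f$ its orientation satisfying $\vec e\le\vec f$ and $\overleftarrow f$ the reverse, $\alpha'(\vec f)=\alpha(\vec f)\vee(X,Y)$ and $\alpha'(\overleftarrow f)=\alpha(\overleftarrow f)\wedge(Y,X)$. A family $\mathcal F$ of finite multisets of elements of $\vec R$ is fixed under shifting if whenever $\sigma\in\mathcal F$, $(T,\alpha)$ is a tame $R$-tree, $\vec e=(t,t')\in\vec E(T)$, $\sigma=\alpha(\vec F_s)$ for some $s\in V(T(\vec e))\setminus\{t\}$, and $(X,Y)\in\vec R$ is linked to $\alpha(\vec e)$, then in the shift $(T(\vec e),\alpha')$ onto $(X,Y)$ with respect to $\vec e$ we have $\alpha'(\vec F_s)\in\mathcal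 F$. For an $S_k$-tree $(T,\alpha)$ over $\mathcal F$, a separation $(A,B)$ is addable at $t\in V(T)$ if $\sigma_t\cup\{(A,B)\}\in\mathcal F$. Such a tree is $\mathcal F$-lean if for every pair of vertices $t,t'$ and every pair of separations $(A,B)\le(B',A')$ with $(A,B)$ addable at $t$ and $(A',B')$ addable at $t'$, either $\lambda((A,B),(B',A'))\ge\min\{r(A),r(A')\}$ or $\min\{|\alpha(\vec g)|_r:\vec g$ an edge of the path $tTt'$ oriented towards $t'\}=\lambda((A,B),(B',A'))$ (the minimum over the empty set, when $t=t'$, being $+\infty$). *)

(* Defs.v *)
From HB Require Import structures.
From mathcomp Require Import all_boot finmap multiset.
From mathcomp Require Import boolp classical_sets.

Set Implicit Arguments.
Unset Strict Implicit.
Unset Printing Implicit Defensive.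

Local Open Scope classical_set_scope.

Section Separations.
Context {V : Type}.

(* Pairs of subsets of V; that such a pair (A, B) covers V is the separate
   predicate [is_sep]. *)
Definition sep : Type := (set V * set V)%type.
HB.instance Definition _ := Choice.on sep.

Implicit Types (a b c x : sep) (S R : set sep).

Definition is_sep a : Prop := a.1 `|` a.2 = setT.
Definition sep_le a b : Prop := a.1 `<=` b.1 /\ b.2 `<=` a.2.
Definition sep_inv a : sep := (a.2, a.1).
Definition sep_meet a b : sep := (a.1 `&` b.1, a.2 `|` b.2).
Definition sep_join a b : sep := (a.1 `|` b.1, a.2 `&` b.2).

Definition is_sep_system S : Prop :=
  (forall a, S a -> is_sep a) /\ (forall a, S a -> S (sep_inv a)).

Definition is_universe S : Prop :=
  [/\ is_sep_system S,
      forall a b, S a -> S b -> S (sep_meet a b) &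
      forall a b, S a -> S b -> S (sep_join a b)].

Definition nondecreasing_setfun (r : set V -> nat) : Prop :=
  forall A B : set V, A `<=` B -> r A <= r B.

Definition submodular (r : set V -> nat) : Prop :=
  forall A B : set V, r (A `|` B) + r (A `&` B) <= r A + r B.

(* The subtraction is the truncated one of nat, but for r submodular and
   nondecreasing and a covering V, r setT <= r a.1 + r a.2, so that no
   truncation takes place. *)
Definition sep_order (r : set V -> nat) a : nat := r a.1 + r a.2 - r setT.

Definition sep_lt_order S (r : set V -> nat) (k : nat) : set sep :=
  [set a | S a /\ sep_order r a < k].

(* The empty set has no minimum; this renders the convention that its minimum
   is +oo when the minimum is compared for equality with a natural number. *)
Definition is_min (P : set nat) (n : nat) : Prop :=
  P n /\ forall m, P m -> n <= m.

(* The value 0 is a dummy, taken only if S has no element between a and c. *)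
Definition lambda S (r : set V -> nat) a c : nat :=
  xget 0 (is_min [set n | exists x,
    [/\ S x, sep_le a x, sep_le x c & n = sep_order r x]]).

Definition linked S (r : set V -> nat) x a : Prop :=
  sep_le a x /\ sep_order r x = lambda S r a x.

(* Removing one copy of a before choosing b makes a and b distinct as members
   of the multiset, while allowing a = b if the multiplicity is at least 2. *)
Definition is_star (s : {mset sep}%mset) : Prop :=
  forall a b, a \in s -> b \in (s `\ a)%mset -> sep_le a (sep_inv b).

End Separations.

Arguments sep : clear implicits.

Section Graphs.
Context {T : finType}.
Variable e : rel T.

Definition acyclic : Prop := forall c : seq T, 2 < size c -> ~ ucycle e c.

Definition is_tree : Prop :=
  [/\ symmetric e, irreflexive e, 0 < #|T|, (forall x y, connect e x y)
    & acyclic].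

(* (x, y) <= (u, v); the one-edge path p = [:: x; y] gives the case of
   equality. *)
Definition oedge_le (x y u v : T) : Prop :=
  exists p : seq T,
    [/\ sorted e p, uniq p, prefix [:: x; y] p & suffix [:: u; v] p].

Definition on_path_between (t t' u v : T) : Prop :=
  exists p : seq T,
    [/\ path e t p, uniq (t :: p), last t p = t' & infix [:: u; v] (t :: p)].

Definition in_comp_minus (x y : T) : pred T :=
  connect [rel u v | [&& e u v, u != x & v != x]] y.

Definition branch_vert (x y : T) : pred T :=
  [pred v | (v == x) || in_comp_minus x y v].

Definition branch_edge (x y : T) : rel T :=
  [rel u v | [|| [&& in_comp_minus x y u, in_comp_minus x y v & e u v],
                 (u == x) && (v == y) | (u == y) && (v == x)]].

End Graphs.

(* A finite graph with a separation attached to each ordered pair of vertices;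
   the values of [lab] at pairs that are not edges are irrelevant. *)
Record sep_graph (V : Type) := SepGraph {
  vert :> finType;
  edge : rel vert;
  lab : vert -> vert -> sep V
}.

Section SepTrees.
Context {V : Type}.
Implicit Types (R S : set (sep V)) (r : set V -> nat) (T : sep_graph V).
Implicit Types (F : set {mset sep V}%mset).

Definition is_sep_tree R T : Prop :=
  is_tree (@edge V T) /\
  forall x y : T, edge x y -> R (lab x y) /\ lab y x = sep_inv (lab x y).

Definition sigma T (t : T) : {mset sep V}%mset :=
  seq_mset [seq lab x t | x <- enum T & edge x t].

Definition tame T : Prop := forall t : T, is_star (sigma t).

Definition tree_over F T : Prop := forall t : T, F (sigma t).

Definition shift_lab T (x y : T) (c : sep V) (u v : T) : sep V :=
  if `[< oedge_le (@edge V T) x y u v >] then sep_join (lab u v) c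
  else sep_meet (lab u v) (sep_inv c).

(* The shift of T onto c with respect to the oriented edge (x, y). *)
Definition shift T (x y : T) (c : sep V) : sep_graph V :=
  @SepGraph V {v : T | branch_vert (@edge V T) x y v}
    (fun u v => branch_edge (@edge V T) x y (val u) (val v))
    (fun u v => shift_lab x y c (val u) (val v)).

Definition fixed_under_shifting S r R F : Prop :=
  forall T (t t' : T) (c : sep V) (s : shift t t' c),
    is_sep_tree R T -> tame T -> edge t t' ->
    R c -> linked S r c (lab t t') ->
    val s != t -> F (sigma (val s)) -> F (sigma s).

Definition addable F T (a : sep V) (t : T) : Prop := F (a +` sigma t)%mset.

Definition lean S r F T : Prop :=
  forall (t t' : T) (a a' : sep V),
    addable F a t -> addable F a' t' -> sep_le a (sep_inv a') ->
    minn (r a.1) (r a'.1) <= lambda S r a (sep_inv a')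
    \/ is_min [set n | exists u v : T, on_path_between (@edge V T) t t' u v /\
                         n = sep_order r (lab u v)]
              (lambda S r a (sep_inv a')).

End SepTrees.

(* Main.v *)
Require Import Defs.
From mathcomp Require Import all_boot finmap multiset.
From mathcomp Require Import boolp classical_sets.
From mathcomp Require Import zify.

(** Write N = r(V) and give a vertex s the weight w(s) = N - sum (N - r(B)),
    summed over the members (A, B) of sigma_s; for graphs this is the size of
    the bag at s.  Among all S_k-trees over F take one for which the numbers of
    vertices of weight >= q plus oriented edges with both ends of weight >= q
    are lexicographically minimal, for q running from N down to 0.

    Suppose that it is not F-lean, witnessed by (A, B) addable at t and (A', B')
    addable at t', and let lambda be their connectivity.  Among the separations
    of order lambda between (A, B) and (B', A') choose x = (X, Y) nested with
    as many edge separations as possible.  Take one copy of T shifted onto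
    (Y, X) from a leaf (A', B') added at t', another copy shifted onto (X, Y)
    from a leaf (A, B) added at t, and identify the two leaf edges; the result
    is again over F.  By submodularity no copy of a vertex is heavier than the
    vertex, the copy of t in the second tree is lighter than t, and likewise
    for t' in the first.  If a copy of s keeps the weight w(s) > lambda, then a
    corner of x and an edge at s has order lambda, so that by the choice of x
    they are nested, which forces the other copy of s to weight <= lambda.  Hence
    above lambda the counts do not increase until some vertex loses weight in
    both copies; if there is no such vertex, the path from t to t' contains an
    edge whose ends keep their weights in different copies, and the edge count
    for q = lambda + 1 decreases. *)

Set Implicit Arguments.
Unset Strict Implicit.
Unset Printing Implicit Defensive.

Local Open Scope classical_set_scope.

(** * Non-backtracking walks in trees *)

Section Walks.
Variables (T : finType) (e : rel T).

(* (x, y) <= (u, v) in the order of oriented edges: in a tree non-backtracking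
   walks are paths, and unlike paths they concatenate without side conditions. *)
Inductive walk (x y : T) : T -> T -> Prop :=
| walk1 : e x y -> walk x y x y
| walkS u v w : walk x y u v -> e v w -> w <> u -> walk x y v w.

Definition away (t u v : T) : Prop := exists y, walk t y u v.

Lemma walk_edge x y u v : walk x y u v -> e u v.
Proof. by case. Qed.

Lemma walk_edge_start x y u v : walk x y u v -> e x y.
Proof. by elim. Qed.

Lemma walk_trans x y u v w z :
  walk x y u v -> walk u v w z -> walk x y w z.
Proof.
by move=> xu; elim=> [//|w1 w2 w3 _ IH e23 n31]; apply: walkS IH e23 n31.
Qed.

Lemma walk_pred x y u v : walk x y u v -> u = x \/ exists z, walk x y z u.
Proof. by case=> [|u' v' w' uv' _ _]; [left | right; exists u']. Qed.

Lemma away_edge t u v : away t u v -> e u v.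
Proof. by case=> y /walk_edge. Qed.

Lemma away_step t u v w : away t u v -> e v w -> w <> u -> away t v w.
Proof. by move=> [y yuv] vw wu; exists y; apply: walkS yuv vw wu. Qed.

Lemma away1 t v : e t v -> away t t v.
Proof. by move=> tv; exists v; apply: walk1. Qed.

(** The two [head] expressions denote the first two vertices of [q ++ [:: u; v]], uniformly in the
    length of [q]. *)
Lemma sorted_walk q u v :
  sorted e (q ++ [:: u; v]) -> uniq (q ++ [:: u; v]) ->
  walk (head u q) (head v (behead (rcons q u))) u v.
Proof.
elim/last_ind: q u v => [|q z IH] u v.
  by rewrite /= andbT => uv _; apply: walk1.
rewrite -cats1 -catA /= => so un.
have E : q ++ [:: z; u; v] = (q ++ [:: z; u]) ++ [:: v] by rewrite -catA.
have [_ /= /and3P[_ uv _]] := cat_sorted2 so.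
move: so (un); rewrite {1 2}E => /cat_sorted2[so _].
rewrite cat_uniq => /andP[un' _].
have W := IH _ _ so un'.
have -> : head u (q ++ [:: z]) = head z q by case: (q).
have -> : head v (behead (rcons (q ++ [:: z]) u))
       = head u (behead (rcons q z)) by case: (q) => [|a [|]].
apply: (walkS W uv) => vz; move: un.
by rewrite vz cat_uniq /= !inE eqxx !orbT /= !andbF.
Qed.

Lemma oedge_le_walk x y u v : oedge_le e x y u v -> walk x y u v.
Proof.
case=> p [so un /prefixP[s1 E1] /suffixP[s2 E2]].
rewrite {}E2 in so un E1.
have := sorted_walk so un.
case: s2 E1 {so un} => [|a [|b s2]] /= [].
- by move=> -> ->.
- by move=> -> ->.
- by move=> -> ->.
Qed.

(** A cycle listed from [x] is a path whose last vertex is adjacent to [x]; the step back to [x]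
    turns its walk into a closed one. *)
Lemma acyclic_walk : (forall x y u, ~ walk x y u x) -> acyclic e.
Proof.
move=> nw c sz /andP[cy un].
case: c sz cy un => [//|x c] sz.
elim/last_ind: c sz => [//|c v _] sz.
elim/last_ind: c sz => [//|c u _] _.
rewrite /= !rcons_path !last_rcons => /andP[/andP[pc uv] vx] un.
have E : x :: rcons (rcons c u) v = (x :: c) ++ [:: u; v].
  by rewrite -!cats1 /= -catA.
have so : sorted e ((x :: c) ++ [:: u; v]) by rewrite -E /= !rcons_path last_rcons pc uv.
have un' : uniq ((x :: c) ++ [:: u; v]) by rewrite -E.
have W := sorted_walk so un'.
apply: (nw x (head v (rcons c u)) v).
apply: walkS W vx _ => xu; move: un.
by rewrite -xu /= mem_rcons inE mem_rcons mem_head orbT.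
Qed.

Hypothesis e_tree : is_tree e.

Let e_sym : symmetric e. Proof. by case: e_tree. Qed.
Let e_irr : irreflexive e. Proof. by case: e_tree. Qed.
Let e_conn x y : connect e x y. Proof. by case: e_tree. Qed.
Let e_acyc : acyclic e. Proof. by case: e_tree. Qed.

Lemma walk_rev x y u v : walk x y u v -> walk v u y x.
Proof.
elim=> [xy|u' v' w' W IH vw wu]; first by apply: walk1; rewrite e_sym.
apply: (walk_trans _ IH).
apply: walkS (nesym wu); first by apply: walk1; rewrite e_sym.
by rewrite e_sym; apply: walk_edge W.
Qed.

Lemma on_path_away t t' u v :
  on_path_between e t t' u v -> away t u v /\ away t' v u.
Proof.
case=> p [pp un lp /infixP[s1 [s2 E]]].
have so : sorted e (t :: p) by [].
rewrite E in so un; split.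
  rewrite -[_ ++ _]/(s1 ++ [:: u; v] ++ s2) catA in so un.
  have [so' _] := cat_sorted2 so; move: un; rewrite cat_uniq => /andP[un _].
  have := sorted_walk so' un; case: s1 E {so so' un} => [|a s1] /= [-> _] W;
  by eexists; apply: W.
have [_ so'] := cat_sorted2 so; move: un; rewrite cat_uniq => /and3P[_ _ un].
have R : rev [:: u, v & s2] = rev s2 ++ [:: v; u].
  by rewrite !rev_cons -!cats1 -catA.
have so2 : sorted e (rev s2 ++ [:: v; u]).
  by rewrite -R rev_sorted; apply: sub_sorted so' => x y; rewrite e_sym.
have un2 : uniq (rev s2 ++ [:: v; u]) by rewrite -R rev_uniq.
have := sorted_walk so2 un2.
have -> : head v (rev s2) = t'.
  rewrite -lp -[last t p]/(last t (t :: p)) E last_cat /=.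
  by elim/last_ind: (s2) => [//|s z _]; rewrite rev_rcons last_rcons.
by move=> W; eexists; apply: W.
Qed.

(** If [w] were already on the path, the segment from [w] to [v] would close a cycle, of length at
    least 3 because [w] is neither [u] nor [v]. *)
Lemma uniq_extend q u v w :
  sorted e (q ++ [:: u; v]) -> uniq (q ++ [:: u; v]) -> e v w -> w <> u ->
  sorted e ((q ++ [:: u]) ++ [:: v; w]) /\ uniq ((q ++ [:: u]) ++ [:: v; w]).
Proof.
move=> so un vw wu; have [_ /= /andP[uv _]] := cat_sorted2 so.
have E : (q ++ [:: u]) ++ [:: v; w] = rcons (q ++ [:: u; v]) w.
  by rewrite -cats1 -!catA.
have so' : sorted e (rcons (q ++ [:: u; v]) w).
  have L : forall x, last x (q ++ [:: u; v]) = v by move=> x; rewrite last_cat.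
  case D : (q ++ [:: u; v]) so L => [//|a s] so L /=.
  by rewrite rcons_path -[last a s]/(last a (a :: s)) L vw andbT.
rewrite {}E; split=> //; rewrite rcons_uniq un andbT; apply/negP => wq.
have wv : w != v by apply/eqP => E; move: vw; rewrite E e_irr.
have {}wq : w \in q.
  by move: wq; rewrite mem_cat !inE (negPf wv) orbF (introF eqP wu) orbF.
case/splitPr: wq un so' {so} => p1 p2.
rewrite -catA cat_uniq => /and3P[_ _ un].
rewrite rcons_cat => /cat_sorted2[_ so].
by apply: (e_acyc (c := w :: p2 ++ [:: u; v])); [rewrite /= size_cat /=; lia | apply/andP].
Qed.

Lemma walk_extend q u v w z :
  sorted e (q ++ [:: u; v]) -> uniq (q ++ [:: u; v]) -> walk u v w z ->
  exists q', [/\ sorted e (q' ++ [:: w; z]), uniq (q' ++ [:: w; z])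
    & prefix (q ++ [:: u; v]) (q' ++ [:: w; z])].
Proof.
move=> so un; elim=> [uv|a b c _ [q' [so' un' pr]] bc ca].
  by exists q; split=> //; apply: prefix_refl.
have [so2 un2] := uniq_extend so' un' bc ca.
exists (q' ++ [:: a]); split=> //; apply: prefix_trans pr _.
by rewrite -!catA prefix_catr //=; rewrite !eqxx.
Qed.

Lemma walk_oedge_le x y u v : walk x y u v -> oedge_le e x y u v.
Proof.
move=> W.
have xy := walk_edge_start W.
have so : sorted e ([::] ++ [:: x; y]) by rewrite /= xy.
have un : uniq ([::] ++ [:: x; y]).
  by rewrite /= !inE andbT; apply/eqP => E; move: xy; rewrite E e_irr.
have [q [so' un' pr]] := walk_extend so un W.
by exists (q ++ [:: u; v]); split=> //; apply: suffix_suffix.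
Qed.

Lemma walk_start_neq x y u : ~ walk x y u x.
Proof.
move/walk_oedge_le => [p [_ un /prefixP[s1 E1] /suffixP[s2 E2]]].
rewrite {}E2 in un E1.
case: s2 E1 un => [|a s2] /= [-> _]; first by rewrite !inE eqxx.
by rewrite mem_cat !inE eqxx !orbT.
Qed.

Lemma away_root t u : ~ away t u t.
Proof. by case=> y /walk_start_neq. Qed.

Lemma away_asym t u v : away t u v -> ~ away t v u.
Proof.
move=> [y W] [y' /walk_rev W'].
exact: walk_start_neq (walk_trans W W').
Qed.

Lemma away_uniq t u u' v : away t u v -> away t u' v -> u = u'.
Proof.
move=> [y W] [y' W']; apply: contrapT => uu'.
have vu' : e v u' by rewrite e_sym; apply: walk_edge W'.
apply: walk_start_neq (walk_trans (walkS W vu' (nesym uu')) (walk_rev W')).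
Qed.

Lemma away_on_path t t' u v : away t u v -> away t' v u -> on_path_between e t t' u v.
Proof.
move=> [y W] [y' /walk_rev W'].
have [p [so un /prefixP[s1 E1] /suffixP[s2 E2]]] := walk_oedge_le W.
rewrite {}E2 in so un E1.
have [q [so' un' /prefixP[s3 E3]]] := walk_extend so un W'.
have E : exists p', s2 ++ [:: u; v] ++ s3 = t :: p'.
  by exists (y :: s1 ++ s3); rewrite catA E1.
case: E => p' E; rewrite E3 -catA E in so' un'.
exists p'; split=> //.
- have := congr1 (last t) E; rewrite catA -E3 last_cat /= => ->.
  by [].
- by rewrite -E; apply/infixP; exists s2, s3.
Qed.

Lemma away_reach t v : v = t \/ exists u, away t u v.
Proof.
have /connectP[p pp ->] := e_conn t v.
elim/last_ind: p pp => [|p w IH]; first by left.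
rewrite rcons_path last_rcons => /andP[/IH[->|[u tu]] vw].
  by right; exists t; apply: away1.
have [->|wu] := pselect (w = u).
  case: tu => y /walk_pred[->|[z W]]; first by left.
  by right; exists z; exists y.
by right; exists (last t p); apply: away_step tu vw wu.
Qed.

Lemma away_total t u v : e u v -> away t u v \/ away t v u.
Proof.
have [->|[z tu]] := away_reach t u => uv; first by left; apply: away1.
have [->|vz] := pselect (v = z); first by right.
by left; apply: away_step tu uv vz.
Qed.
End Walks.

(** * Gluing two trees along a new edge *)

Definition glue_rel (T1 T2 : finType) (e1 : rel T1) (e2 : rel T2)
    (v1 : T1) (v2 : T2) : rel (T1 + T2)%type :=
  fun p q => match p, q with
  | inl u, inl v => e1 u v
  | inr u, inr v => e2 u v
  | inl u, inr v => (u == v1) && (v == v2)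
  | inr u, inl v => (v == v1) && (u == v2)
  end.

Definition sum_swap (A B : Type) (p : A + B) : B + A :=
  match p with inl a => inr a | inr b => inl b end.

Lemma sum_swap_inj A B : injective (@sum_swap A B).
Proof. by move=> [a|b] [a'|b'] //= [->]. Qed.

Lemma walk_map (T T' : finType) (e : rel T) (e' : rel T') (f : T -> T') :
  injective f -> (forall u v, e u v -> e' (f u) (f v)) ->
  forall x y u v, walk e x y u v -> walk e' (f x) (f y) (f u) (f v).
Proof.
move=> injf ef x y u v; elim=> [xy|a b c _ IH bc ca]; first exact/walk1/ef.
by apply: walkS IH (ef _ _ bc) _ => /injf.
Qed.

Lemma connect_homo (T T' : finType) (e : rel T) (e' : rel T') (f : T -> T') :
  (forall u v, e u v -> e' (f u) (f v)) ->
  forall x y, connect e x y -> connect e' (f x) (f y).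
Proof.
move=> ef x _ /connectP[p pp ->]; apply/connectP; exists (map f p).
  by elim: p x pp => //= y p IH x /andP[/ef-> /IH].
by rewrite last_map.
Qed.

Lemma glue_rel_swap (T1 T2 : finType) (e1 : rel T1) (e2 : rel T2) v1 v2 p q :
  glue_rel e1 e2 v1 v2 p q =
  glue_rel e2 e1 v2 v1 (sum_swap p) (sum_swap q).
Proof. by case: p q => [u|u] [v|v] //=; rewrite andbC. Qed.

(** Once across the bridge, a walk moves away from [v2] in the right tree; it never reaches [v2]
    again and so cannot return to the left. *)
Lemma glue_walk_left (T1 T2 : finType) (e1 : rel T1) (e2 : rel T2) v1 v2 x y u :
  is_tree e1 -> is_tree e2 ->
  ~ walk (glue_rel e1 e2 v1 v2) (inl x) y u (inl x).
Proof.
move=> tr1 tr2; set e := glue_rel _ _ _ _.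
have inv p q : walk e (inl x) y p q ->
  [\/ exists y' u' v', [/\ y = inl y', p = inl u', q = inl v' & walk e1 x y' u' v'],
      p = inl v1 /\ q = inr v2 |
      exists u' v', [/\ p = inr u', q = inr v' & away e2 v2 u' v']].
  elim=> [xy|a b c _ IH bc ca].
    case: y xy => y' /=.
      by move=> ?; constructor 1; exists y', x, y'; split=> //; apply: walk1.
    by case/andP => /eqP-> /eqP->; constructor 2.
  case: IH ca bc => [[y' [u' [v' [-> -> -> W]]]]|[-> ->]|[u' [v' [-> -> W]]]]; case: c => w.
  - move=> ne /= vw; constructor 1; exists y', v', w; split=> //.
    by apply: walkS W vw _ => E; apply: ne; rewrite E.
  - by move=> _ /= /andP[/eqP-> /eqP->]; constructor 2.
  - by move=> ne /= /andP[/eqP E _]; case: ne; rewrite E.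
  - by move=> _ /= vw; constructor 3; exists v2, w; split=> //; apply: away1.
  - by move=> _ /= /andP[_ /eqP E]; rewrite E in W; case: (away_root tr2 W).
  - move=> ne /= vw; constructor 3; exists v', w; split=> //.
    by apply: away_step W vw _ => E; apply: ne; rewrite E.
move/inv => [[y' [u' [v' [_ _ [<-] W]]]]|[_ //]|[u' [v' [_ //]]]].
exact: (walk_start_neq tr1 W).
Qed.

Lemma glue_tree (T1 T2 : finType) (e1 : rel T1) (e2 : rel T2) v1 v2 :
  is_tree e1 -> is_tree e2 -> is_tree (glue_rel e1 e2 v1 v2).
Proof.
move=> tr1 tr2; have [sy1 ir1 n1 co1 _] := tr1; have [sy2 ir2 n2 co2 _] := tr2.
set e := glue_rel _ _ _ _.
have syE : symmetric e by move=> [u|u] [v|v] //=.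
have irrE : irreflexive e by move=> [u|u] //=.
have csym := sym_connect_sym syE.
split=> //.
- by rewrite card_sum addn_gt0 n1.
- have c1 u : connect e (inl v1) (inl u) by apply: connect_homo (co1 v1 u).
  have c2 u : connect e (inl v1) (inr u).
    apply: (@connect_trans _ _ (inr v2)).
      by apply: connect1; rewrite /= !eqxx.
    by apply: connect_homo (co2 v2 u).
  have c p : connect e (inl v1) p by case: p.
  by move=> x y; apply: connect_trans (c y); rewrite csym.
- apply: acyclic_walk => -[x|x] y u W; first exact: (glue_walk_left tr1 tr2 W).
  have := walk_map (@sum_swap_inj _ _) _ W.
  move/(_ (glue_rel e2 e1 v2 v1)) => H.
  by apply: (glue_walk_left tr2 tr1 (H _)) => p q; rewrite /e glue_rel_swap.
Qed.

Definition no_edge : rel unit := fun _ _ => false.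

Lemma no_edge_tree : is_tree no_edge.
Proof.
split=> //; first by rewrite card_unit.
- by move=> [] []; apply: connect0.
- by move=> [|[] [|[] c]] // _ /andP[].
Qed.

(** Rooting a tree at [t] is the same as ordering its edges from a new leaf edge at [t]; this
    translates between [root_shift] and [shift]. *)
Lemma away_glue_leaf (T : finType) (e : rel T) t u v : is_tree e ->
  walk (glue_rel e no_edge t tt) (inr tt) (inl t) (inl u) (inl v)
  <-> away e t u v.
Proof.
move=> tr; split=> [W|[y]].
  have inv p q : walk (glue_rel e no_edge t tt) (inr tt) (inl t) p q ->
      (p = inr tt /\ q = inl t) \/
      exists u' v', [/\ p = inl u', q = inl v' & away e t u' v'].
    elim=> [|a b c _ IH bc ca]; first by left.
    right; case: IH bc ca => [[-> ->]|[u' [v' [-> -> W']]]]; case: c => w /= vw ne.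
    - by exists t, w; split=> //; apply: away1.
    - by case: w vw ne => _ [].
    - by exists v', w; split=> //; apply: away_step W' vw _ => E; apply: ne; rewrite E.
    - by case/andP: vw => /eqP E _; rewrite E in W'; case: (away_root tr W').
  by case: (inv _ _ W) => [[]//|[u' [v' [[->] [->] //]]]].
elim=> [ty|a b c _ IH bc ca].
  by apply: (@walkS _ _ _ _ (inr tt)) => //; apply: walk1; rewrite /= !eqxx.
by apply: (walkS IH) => // -[].
Qed.

(** * Separations, submodularity and lexicographic minimality *)

Section SepLemmas.
Context {V : Type}.
Implicit Types (a b c f g x y : sep V) (S : set (sep V)).

Lemma sep_invK a : sep_inv (sep_inv a) = a. Proof. by case: a. Qed.

Lemma sep_le_refl a : sep_le a a. Proof. by split. Qed.

Lemma sep_le_trans b a c : sep_le a b -> sep_le b c -> sep_le a c.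
Proof. by move=> [ab ba] [bc cb]; split=> v; [move/ab/bc | move/cb/ba]. Qed.

Lemma sep_le_inv a b : sep_le a b -> sep_le (sep_inv b) (sep_inv a).
Proof. by case. Qed.

Lemma sep_le_invr a b : sep_le a (sep_inv b) -> sep_le b (sep_inv a).
Proof. by case. Qed.

Lemma sep_le_meet a b c : sep_le a b -> sep_le a c -> sep_le a (sep_meet b c).
Proof.
move=> [ab ba] [ac ca]; split=> v /=; first by move=> av; split; [exact: ab|exact: ac].
by case=> [/ba|/ca].
Qed.

Lemma sep_meet_lel a b : sep_le (sep_meet a b) a.
Proof. by split=> v /=; [case | left]. Qed.

Lemma sep_meet_ler a b : sep_le (sep_meet a b) b.
Proof. by split=> v /=; [case | right]. Qed.

Lemma sep_join_r a b : sep_le a b -> sep_join a b = b.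
Proof.
by case: a b => [A B] [C D] [/= AC DB]; rewrite /sep_join /= setUidr // setIidr.
Qed.

Lemma sep_inv_meet a b : sep_inv (sep_meet a b) = sep_join (sep_inv a) (sep_inv b).
Proof. by []. Qed.

Definition nested a b : Prop :=
  [\/ sep_le a b, sep_le a (sep_inv b), sep_le b a | sep_le (sep_inv b) a].

Lemma nested_invl a b : nested a b -> nested (sep_inv a) b.
Proof.
case=> [/sep_le_inv ?|/sep_le_invr ?|/sep_le_inv ?|/sep_le_inv];
  rewrite ?sep_invK => *; by [constructor 4|constructor 3|constructor 2|constructor 1].
Qed.

(* If f and x cross, whatever is nested with both is nested with their corners. *)
Lemma nested_meet f x g : ~ nested x f -> nested x g -> nested f g ->
  nested (sep_meet f x) g.
Proof.
move=> nxf xg fg.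
have ml := sep_meet_lel f x; have mr := sep_meet_ler f x.
case: xg => [h|h|xg|xg].
- by constructor 1; apply: sep_le_trans h.
- by constructor 2; apply: sep_le_trans h.
- case: fg => [h|h|h|h].
  + by constructor 1; apply: sep_le_trans h.
  + by constructor 2; apply: sep_le_trans h.
  + by constructor 3; apply: sep_le_meet.
  + case: nxf; constructor 4; apply: sep_le_trans xg.
    by rewrite -(sep_invK g); apply: sep_le_inv.
- case: fg => [h|h|h|h].
  + by constructor 1; apply: sep_le_trans h.
  + by constructor 2; apply: sep_le_trans h.
  + case: nxf; constructor 4; apply: sep_le_trans xg; exact: sep_le_inv.
  + by constructor 4; apply: sep_le_meet.
Qed.

Variable r : set V -> nat.
Hypotheses (r_mono : nondecreasing_setfun r) (r_sub : submodular r).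

Lemma sep_order_inv a : sep_order r (sep_inv a) = sep_order r a.
Proof. by rewrite /sep_order /= addnC. Qed.

Lemma sep_orderE a : is_sep a -> r a.1 + r a.2 = sep_order r a + r setT.
Proof. by move=> sa; have := r_sub a.1 a.2; rewrite sa /sep_order; lia. Qed.

(** By submodularity the order of [a] is at least [r] of the separator, the intersection of its two
    sides. *)
Lemma separator_order a A : is_sep a -> A `<=` a.1 -> A `<=` a.2 ->
  r A <= sep_order r a.
Proof.
move=> sa A1 A2; have := r_sub a.1 a.2; rewrite sa /sep_order.
have : r A <= r (a.1 `&` a.2) by apply: r_mono => v Av; split; [apply: A1|apply: A2].
lia.
Qed.

(** Induction on [l]. A point of [X] outside [B i] lies in all the other sets, so [Z] and the
    intersection of [X] with [B i] have union [X]. Adding submodularity for this pair to that for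
    [B i] and [X] gives the step. *)
Lemma star_sum_seq (J : eqType) (l : seq J) (B : J -> set V) (X : set V) :
  uniq l -> {in l &, forall i j, i != j -> B i `|` B j = setT} ->
  \sum_(i <- l) (r setT - r (B i)) +
    r (X `&` [set v | forall i, i \in l -> B i v]) <=
  \sum_(i <- l) (r setT - r (B i `|` X)) + r X.
Proof.
elim: l => [|i l IH] /=; first by rewrite !big_nil => _ _; apply: r_mono => v [].
move=> /andP[il ul] st; rewrite !big_cons.
have {}IH := IH ul (sub_in2 (fun j jl => mem_behead (s := i :: l) jl) st).
set Z := X `&` _ in IH; set Z' := X `&` _.
have EZ : Z' = Z `&` (X `&` B i).
  apply/seteqP; split=> v /=.
    move=> [Xv h]; split; first by split=> // j jl; apply: h; rewrite inE jl orbT.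
    by split=> //; apply: h; rewrite mem_head.
  by move=> [[Xv h] [_ Bv]]; split=> // j; rewrite inE => /predU1P[->//|/h].
have EX : Z `|` (X `&` B i) = X.
  apply/seteqP; split=> v /=; first by case=> [[]|[]].
  move=> Xv; have [Bv|nB] := pselect (B i v); [by right|left; split=> // j jl].
  have ij : i != j by apply: contraNneq il => ->.
  have := st i j (mem_head _ _) (mem_behead (s := i :: l) jl) ij.
  by move/seteqP=> [_ /(_ v I)[]].
have := r_sub Z (X `&` B i); rewrite -EZ EX.
have := r_sub (B i) X; rewrite [B i `&` X]setIC.
have := r_mono (@subsetT _ (B i)); have := r_mono (@subsetT _ (B i `|` X)).
lia.
Qed.

Lemma star_sum (T : finType) (P : pred T) (B : T -> set V) (X U : set V) :
  (forall i j, P i -> P j -> i != j -> B i `|` B j = setT) ->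
  U `<=` X -> (forall i, P i -> U `<=` B i) ->
  \sum_(i | P i) (r setT - r (B i)) + r U <=
  \sum_(i | P i) (r setT - r (B i `|` X)) + r X.
Proof.
move=> st UX UB; rewrite -big_filter -[Y in _ <= Y + _]big_filter.
have := @star_sum_seq _ [seq i <- index_enum T | P i] B X
  (filter_uniq _ (index_enum_uniq T)).
have mP i : i \in [seq i <- index_enum T | P i] -> P i by rewrite mem_filter => /andP[].
move/(_ (fun i j il jl => st i j (mP i il) (mP j jl))); apply: leq_trans.
rewrite leq_add2l; apply: r_mono => v Uv.
by split; [apply: UX | move=> i /mP Pi; apply: UB].
Qed.

(** The case [X = setT] of [star_sum], in which every summand on the right vanishes. *)
Lemma star_bound (T : finType) (P : pred T) (B : T -> set V) (U : set V) :
  (forall i j, P i -> P j -> i != j -> B i `|` B j = setT) ->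
  (forall i, P i -> U `<=` B i) ->
  \sum_(i | P i) (r setT - r (B i)) + r U <= r setT.
Proof.
move=> st UB; apply: leq_trans (star_sum st (@subsetT _ U) UB) _.
by rewrite big1 // => i _; rewrite setUT subnn.
Qed.

End SepLemmas.

Lemma ex_argmin (X : Type) (P : X -> Prop) (f : X -> nat) :
  (exists x, P x) -> exists x, P x /\ forall y, P y -> f x <= f y.
Proof.
case=> x Px; have [n] := ubnP (f x); elim: n x Px => // n IH x Px fx.
have [[y [Py fy]]|no] := pselect (exists y, P y /\ f y < f x).
  by apply: (IH y Py); lia.
exists x; split=> // y Py; rewrite leqNgt; apply/negP => fy.
by apply: no; exists y.
Qed.

Lemma ex_lexmin (X : Type) (P : X -> Prop) (f : nat -> X -> nat) n :
  (exists x, P x) -> exists x, P x /\ forall y, P y -> forall i, i < n ->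
    (forall j, j < i -> f j y <= f j x) -> f i x <= f i y.
Proof.
move=> exP; elim: n => [|n [x0 [Px0 min0]]]; first by case: exP => x Px; exists x.
pose Q y := P y /\ forall j, j < n -> f j y <= f j x0.
have [|x [[Px Qx] minx]] := @ex_argmin X Q (f n); first by exists x0.
exists x; split=> // y Py i; rewrite ltnS leq_eqVlt => /predU1P[->|ltin] le.
  by apply: minx; split=> // j jn; apply: leq_trans (le j jn) (Qx j jn).
apply: leq_trans (Qx i ltin) _; apply: min0 => // j ji.
by apply: leq_trans (le j ji) (Qx j _); lia.
Qed.

Section Lambda.
Context {V : Type} (S : set (sep V)) (r : set V -> nat).

(** Since [a] itself lies between [a] and [c], the minimum exists and the dummy value of [lambda]
    does not occur. *)
Lemma lambdaP a c : S a -> sep_le a c ->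
  is_min [set n | exists x, [/\ S x, sep_le a x, sep_le x c & n = sep_order r x]]
    (lambda S r a c).
Proof.
move=> Sa ac; set M := is_min _.
have [|x [[Sx ax xc] minx]] :=
  @ex_argmin _ (fun x => [/\ S x, sep_le a x & sep_le x c]) (sep_order r).
  by exists a; split=> //; apply: sep_le_refl.
apply: (@xgetPex _ 0 M); exists (sep_order r x); split; first by exists x.
by move=> m [y [Sy ay yc ->]]; apply: minx.
Qed.
End Lambda.

(** * Stars of glued and shifted trees *)

Section Sigma.
Context {V : Type}.
Implicit Types (T G H : sep_graph V).

Lemma in_seq_mset (K : choiceType) (l : seq K) a : (a \in seq_mset l) = (a \in l).
Proof. exact: perm_mem (perm_eq_seq_mset l) a. Qed.

Lemma mem_sigma T (x t : T) : edge x t -> lab x t \in sigma t.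
Proof.
move=> xt; rewrite in_seq_mset; apply: (map_f (fun z => lab z t)).
by rewrite mem_filter xt mem_enum.
Qed.

(** Removing one copy of [lab x t] from the multiset amounts to removing the neighbour [x] from the
    list, so distinct members of the star are distinct neighbours, whatever their labels. *)
Lemma is_star_sigma T (t : T) :
  is_star (sigma t) <->
  (forall x y : T, edge x t -> edge y t -> x <> y ->
     sep_le (lab x t) (sep_inv (lab y t))).
Proof.
set l := [seq x <- enum T | edge x t].
have ul : uniq l by rewrite filter_uniq ?enum_uniq.
have ml x : (x \in l) = edge x t by rewrite mem_filter mem_enum andbT.
have sE x : edge x t ->
    sigma t = (lab x t +` seq_mset [seq lab z t | z <- rem x l])%mset.
  rewrite -ml => /perm_to_rem /(perm_map (fun z => lab z t)) /eq_seq_msetP.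
  by rewrite /= mset_cons.
have sK x : edge x t ->
    (sigma t `\ lab x t)%mset = seq_mset [seq lab z t | z <- rem x l].
  by move=> xt; rewrite (sE x xt) msetDKB.
split=> [st x y xt yt xy|st a b].
  apply: st; first exact: mem_sigma.
  rewrite sK // in_seq_mset; apply: (map_f (fun z => lab z t)).
  by rewrite mem_rem_uniq // inE /= ml yt andbT; apply/eqP => /esym.
rewrite in_seq_mset => /mapP[x]; rewrite -/l ml => xt ->.
rewrite sK // in_seq_mset => /mapP[y]; rewrite mem_rem_uniq // inE /= ml => /andP[yx yt] ->.
by apply: st => // E; rewrite E eqxx in yx.
Qed.

Lemma sigma_iso G H (f : G -> H) (s : G) :
  injective f ->
  (forall x, edge (f x) (f s) = edge x s) ->
  (forall y, edge y (f s) -> exists x, y = f x) ->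
  (forall x, edge x s -> lab (f x) (f s) = lab x s) ->
  sigma (f s) = sigma s.
Proof.
move=> injf ef surj labf; apply/eq_seq_msetP.
have -> : [seq lab x s | x <- enum G & edge x s] =
    [seq lab y (f s) | y <- [seq f x | x <- enum G & edge x s]].
  rewrite -map_comp; apply/eq_in_map => x; rewrite mem_filter => /andP[xs _].
  by rewrite /= labf.
apply: perm_map; apply: uniq_perm.
- by rewrite filter_uniq ?enum_uniq.
- by rewrite map_inj_uniq // filter_uniq ?enum_uniq.
move=> y; rewrite mem_filter mem_enum andbT; apply/idP/mapP.
  move=> ys; have [x E] := surj y ys; exists x => //.
  by rewrite mem_filter mem_enum andbT -ef -E.
by move=> [x]; rewrite mem_filter => /andP[xs _] ->; rewrite ef.
Qed.

(** The bridge carries [c] from [w] to [v]: thus [c] joins the star at [v] and its inverse the star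
    at [w]. *)
Definition glue G H (v : G) (w : H) (c : sep V) : sep_graph V :=
  @SepGraph V (G + H)%type (glue_rel (@edge V G) (@edge V H) v w)
    (fun p q => match p, q with
     | inl x, inl y => lab x y
     | inr x, inr y => lab x y
     | inl _, inr _ => sep_inv c
     | inr _, inl _ => c
     end).

Definition point : sep_graph V := SepGraph no_edge (fun _ _ => (set0, set0)).

Definition add_leaf T (t : T) (a : sep V) : sep_graph V :=
  @glue T point t tt a.

(** The shift from a leaf at [t] with the leaf deleted. It keeps the vertices of [T], so that
    several shifts can be compared vertex by vertex. *)
Definition root_shift T (t : T) (x : sep V) : sep_graph V :=
  @SepGraph V T (@edge V T)
    (fun u v => if `[< away (@edge V T) t u v >] then sep_join (lab u v) x
                else sep_meet (lab u v) (sep_inv x)).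

Lemma sigma_leaf_root T (t : T) a :
  sigma (inl t : add_leaf t a) = (a +` sigma t)%mset.
Proof.
rewrite -mset_cons; apply/eq_seq_msetP.
pose f (p : add_leaf t a) := lab p (inl t : add_leaf t a).
have -> : a :: [seq lab x t | x <- enum T & edge x t] =
    map f ((inr tt : add_leaf t a) :: [seq inl x | x <- enum T & edge x t]).
  by rewrite /= -map_comp.
apply: perm_map; apply: uniq_perm.
- by rewrite filter_uniq ?enum_uniq.
- rewrite cons_uniq; apply/andP; split; first by apply/mapP => -[].
  rewrite map_inj_uniq; last by move=> ? ? [].
  by rewrite filter_uniq ?enum_uniq.
move=> p; rewrite mem_filter mem_enum andbT inE; case: p => [x|[]] /=; last by rewrite !eqxx.
rewrite mem_map; last by move=> ? ? [].
by rewrite mem_filter mem_enum andbT.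
Qed.

Lemma sigma_leaf_other T (t : T) a s : s <> t ->
  sigma (inl s : add_leaf t a) = sigma s.
Proof.
move=> st; apply: (@sigma_iso T (add_leaf t a) inl) => //; first by move=> ? ? [].
by case=> [x _|[]] /=; [exists x | move=> /andP[/eqP]].
Qed.

Lemma sigma_glue_l G H (v : G) (w : H) c (s : G) :
  sigma (inl s : glue v w c) = sigma (inl s : add_leaf v c).
Proof.
pose f (p : add_leaf v c) : glue v w c :=
  match p with inl x => inl x | inr _ => inr w end.
apply: (@sigma_iso (add_leaf v c) (glue v w c) f (inl s)) => //.
- by move=> [x|[]] [y|[]] //= [->].
- by case=> [x|[]] //=; rewrite !eqxx.
- by case=> [x _|x /= /andP[_ /eqP->]]; [exists (inl x) | exists (inr tt)].
- by case=> [x|[]].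
Qed.

Lemma sigma_glue_r G H (v : G) (w : H) c (s : H) :
  sigma (inr s : glue v w c) = sigma (inl s : add_leaf w (sep_inv c)).
Proof.
pose f (p : add_leaf w (sep_inv c)) : glue v w c :=
  match p with inl x => inr x | inr _ => inl v end.
apply: (@sigma_iso (add_leaf w (sep_inv c)) (glue v w c) f (inl s)) => //.
- by move=> [x|[]] [y|[]] //= [->].
- by case=> [x|[]] //=; rewrite !eqxx ?andbT.
- by case=> [x /= /andP[/eqP-> _]|x _]; [exists (inr tt) | exists (inl x)].
- by case=> [x|[]].
Qed.

Lemma branch_leaf (T : finType) (e : rel T) t s : is_tree e ->
  branch_vert (glue_rel e no_edge t tt) (inr tt) (inl t) (inl s).
Proof.
move=> [_ _ _ co _]; rewrite /branch_vert /= /in_comp_minus.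
by apply: (@connect_homo _ _ e _ inl) => // u v uv /=; rewrite uv.
Qed.

Lemma branch_edge_leaf (T : finType) (e : rel T) t p q : is_tree e ->
  branch_edge (glue_rel e no_edge t tt) (inr tt) (inl t) p q =
  glue_rel e no_edge t tt p q.
Proof.
move=> tr; have bv s : in_comp_minus (glue_rel e no_edge t tt) (inr tt) (inl t) (inl s).
  by have := branch_leaf t s tr; rewrite /branch_vert /=.
rewrite /branch_edge; case: p q => [u|[]] [v|[]] /=; rewrite ?bv /= ?orbF //.
- by rewrite andbF orbF.
- apply/idP/idP => [/orP[/and3P[_ -> ->] //|/andP[/eqP[->] _]]|/andP[/eqP-> _]];
    by rewrite !eqxx ?orbT.
- apply/idP/idP => [/orP[/and3P[_ -> ->] //|/eqP[->]]|/andP[/eqP-> _]];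
    by rewrite !eqxx ?orbT.
- by rewrite !andbF.
Qed.

(** The whole tree lies beyond the leaf edge, whose own label [a] becomes the join of [a] and [x],
    which is [x] because [a] is below [x]. *)
Lemma sigma_shift_leaf T (t : T) a x (s : T)
    (p : shift (inr tt : add_leaf t a) (inl t) x) :
  is_tree (@edge V T) -> sep_le a x -> val p = inl s ->
  sigma p = sigma (inl s : add_leaf (t : root_shift t x) x).
Proof.
move=> tr ax ps.
pose f (q : shift (inr tt : add_leaf t a) (inl t) x) :
  add_leaf (t : root_shift t x) x := val q.
have -> : (inl s : add_leaf (t : root_shift t x) x) = f p by rewrite /f ps.
symmetry; apply: sigma_iso.
- exact: val_inj.
- by move=> q; rewrite /= branch_edge_leaf.
- case=> [u|[]] _; first by exists (exist _ (inl u) (branch_leaf t u tr)).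
  by exists (exist _ (inr tt) isT).
- move=> [q hq]; rewrite /= branch_edge_leaf // ps /f ps /=.
  case: q {hq} => [u|[]] /= qs.
  + rewrite /shift_lab; congr (if _ then _ else _).
    have tr' := glue_tree t tt tr no_edge_tree.
    apply/asboolP/asboolP => W.
      by apply: (walk_oedge_le tr'); apply/(away_glue_leaf t u s tr).
    by apply/(away_glue_leaf t u s tr)/oedge_le_walk.
  + case/andP: qs => /eqP-> _; rewrite /shift_lab asboolT ?sep_join_r //.
    apply: (walk_oedge_le (glue_tree t tt tr no_edge_tree)).
    by apply: walk1; rewrite /= !eqxx.
Qed.

End Sigma.

(** * Weights *)

Section Weights.
Context {V : Type} (r : set V -> nat).

Definition defect (T : sep_graph V) (s : T) : nat :=
  \sum_(y : T | edge y s) (r setT - r (lab y s).2).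

(** For a star of separations the subtraction is exact, by [star_bound]. *)
Definition weight (T : sep_graph V) (s : T) : nat := r setT - defect s.

(* The defect at s of T shifted onto x from a leaf at t; the last summand is the
   contribution of the leaf edge. *)
Definition shift_defect (T : sep_graph V) (t : T) (x : sep V) (s : T) : nat :=
  @defect (root_shift t x) s + (s == t) * (r setT - r x.2).

Variable (S : set (sep V)) (T : sep_graph V).
Hypotheses (r_mono : nondecreasing_setfun r) (r_sub : submodular r).
Hypothesis S_univ : is_universe S.
Hypothesis tr : is_tree (@edge V T).
Hypothesis labS : forall u v : T, edge u v -> S (lab u v).
Hypothesis labI : forall u v : T, edge u v -> lab v u = sep_inv (lab u v).
Hypothesis starT : forall s u v : T, edge u s -> edge v s -> u <> v ->
  sep_le (lab u s) (sep_inv (lab v s)).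

Implicit Types s t u v i : T.

Let N := r setT.
Let r_le (A : set V) : r A <= N. Proof. exact: r_mono. Qed.

Let Ssep x : S x -> is_sep x.
Proof. by case: S_univ => -[h _] _ _; apply: h. Qed.

Let esym : symmetric (@edge V T). Proof. by case: tr. Qed.

(** The star condition at each inner vertex compares consecutive labels. *)
Lemma lab_walk x y u v : walk (@edge V T) x y u v -> sep_le (lab x y) (lab u v).
Proof.
elim=> [_|a b c W IH bc ca]; first exact: sep_le_refl.
apply: sep_le_trans IH _; have := starT (walk_edge W) _ (nesym ca).
rewrite esym => /(_ bc); by rewrite (labI bc) sep_invK.
Qed.

Lemma lab_away t a u v :
  (forall y, edge t y -> sep_le a (lab t y)) ->
  away (@edge V T) t u v -> sep_le a (lab u v).
Proof.
move=> at_ [y W]; apply: sep_le_trans (lab_walk W); apply: at_.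
exact: walk_edge_start W.
Qed.

Lemma lab_away_edge u v (u' v' : T) : edge u v -> away (@edge V T) u u' v' ->
  sep_le (lab u v) (lab u' v') \/ sep_le (sep_inv (lab u v)) (lab u' v').
Proof.
move=> uv [y W]; have [E|ne] := pselect (y = v).
  by left; rewrite -E; apply: lab_walk.
right; rewrite -labI //; apply: lab_walk; apply: walk_trans (W).
by apply: walkS (walk_edge_start W) ne; apply: walk1; rewrite esym.
Qed.

Lemma lab_nested u v (u' v' : T) : edge u v -> edge u' v' ->
  nested (lab u v) (lab u' v').
Proof.
move=> uv uv'; have [A|A] := away_total tr u uv';
  have := lab_away_edge uv A; rewrite ?(labI uv').
  case=> [h|/sep_le_inv]; first by constructor 1.
  by rewrite sep_invK; constructor 4.
case=> [h|/sep_le_inv]; first by constructor 2.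
by rewrite !sep_invK; constructor 3.
Qed.

Lemma lab_cover s u v : edge u s -> edge v s -> u != v ->
  (lab u s).2 `|` (lab v s).2 = setT.
Proof.
move=> us vs /eqP uv; have [h _] := starT us vs uv.
apply/seteqP; split=> // z _; have /seteqP[_ /(_ z I)] := Ssep (labS us).
by case=> [/h|]; [right|left].
Qed.

(** The first side of [lab u s] lies in the second sides of all other members of the star, so
    [star_bound] applies to these. *)
Lemma order_le_weight u s : edge u s -> sep_order r (lab u s) <= weight s.
Proof.
move=> us; rewrite /weight /defect (bigD1 u) //=.
have : \sum_(y : T | edge y s && (y != u)) (N - r (lab y s).2) + r (lab u s).1 <= N.
  apply: star_bound => // [i j /andP[is_ _] /andP[js _]|i /andP[is_ iu]].
    exact: lab_cover.
  by have [] := starT us is_ (nesym (elimN eqP iu)).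
have := sep_orderE r_sub (Ssep (labS us)).
have := r_le (lab u s).2; rewrite /N; lia.
Qed.

Lemma star_le_weight t a : (forall y, edge t y -> sep_le a (lab t y)) ->
  r a.1 <= weight t.
Proof.
move=> at_; rewrite /weight /defect.
have : \sum_(y : T | edge y t) (N - r (lab y t).2) + r a.1 <= N.
  apply: star_bound => // [i j|i it]; first exact: lab_cover.
  have ti : edge t i by rewrite esym.
  by have [] := at_ _ ti; rewrite (labI it).
rewrite /N; lia.
Qed.

Section Side.
Variables (t : T) (a x : sep V).
Hypotheses (Sx : S x) (ax : sep_le a x).
Hypothesis at_ : forall y, edge t y -> sep_le a (lab t y).

Let labt y : edge y t -> a.1 `<=` (lab y t).2.
Proof.
move=> yt; have ty : edge t y by rewrite esym.
by have [] := at_ ty; rewrite (labI yt).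
Qed.

(** All edges at the root are shifted the same way, so [star_sum] applies to the whole star; the
    leaf edge supplies the rest of the order of [x]. Hence [t] gets lighter as soon as [r a.1]
    exceeds that order. *)
Lemma shift_defect_root : defect t + r a.1 <= shift_defect t x t + sep_order r x.
Proof.
rewrite /shift_defect eqxx mul1n.
have -> : @defect (root_shift t x) t =
    \sum_(y : T | edge y t) (r setT - r ((lab y t).2 `|` x.1)).
  by apply: eq_bigr => y _ /=; rewrite asboolF //; apply: away_root.
rewrite /defect.
have : \sum_(y : T | edge y t) (N - r (lab y t).2) + r a.1 <=
    \sum_(y : T | edge y t) (N - r ((lab y t).2 `|` x.1)) + r x.1.
  apply: star_sum => // [i j|]; first exact: lab_cover.
  by case: ax.
have := sep_orderE r_sub (Ssep Sx); have := r_le x.2.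
rewrite /N; lia.
Qed.

Lemma shift_defect_parent i s : away (@edge V T) t i s ->
  shift_defect t x s =
  (N - r ((lab i s).2 `&` x.2)) +
  \sum_(y : T | edge y s && (y != i)) (N - r ((lab y s).2 `|` x.1)).
Proof.
move=> ti; rewrite /shift_defect; have [E|_] := eqVneq s t.
  by rewrite E in ti; case: (away_root tr ti).
rewrite mul0n addn0 /defect (bigD1 (i : T)) /=; last exact: away_edge ti.
rewrite asboolT //=; congr (_ + _); apply: eq_bigr => y /andP[_ yi].
by rewrite asboolF // => ty; case/eqP: yi; exact: (away_uniq tr ty ti).
Qed.

(** Submodularity of the second sides treats the edge from the parent [i], and [star_sum] the edges
    from the other neighbours; together they produce the order of the corner. *)
Lemma shift_defect_corner i s : away (@edge V T) t i s ->
  defect s + sep_order r (sep_meet (lab i s) x) <=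
  shift_defect t x s + sep_order r x.
Proof.
move=> ti; have is_ := away_edge ti; rewrite (shift_defect_parent ti).
rewrite /defect (bigD1 (i : T)) //=.
have : \sum_(y : T | edge y s && (y != i)) (N - r (lab y s).2) +
         r ((lab i s).1 `&` x.1) <=
    \sum_(y : T | edge y s && (y != i)) (N - r ((lab y s).2 `|` x.1)) + r x.1.
  apply: star_sum => // [j j' /andP[js _] /andP[js' _]|j /andP[js ji] v [iv _]].
  - exact: lab_cover.
  - by have [h _] := starT is_ js (nesym (elimN eqP ji)); apply: h.
have := r_sub (lab i s).2 x.2.
have := sep_orderE r_sub (Ssep Sx).
have /Ssep/(sep_orderE r_sub) : S (sep_meet (lab i s) x).
  by case: S_univ => _ h _; apply: h => //; apply: labS.
have := r_le (lab i s).2; have := r_le ((lab i s).2 `&` x.2).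
rewrite /N /=; lia.
Qed.

Lemma shift_defect_ge s : sep_order r x <= r a.1 ->
  (forall u v, away (@edge V T) t u v ->
     sep_order r x <= sep_order r (sep_meet (lab u v) x)) ->
  defect s <= shift_defect t x s.
Proof.
move=> xra corner; have [->|[i ti]] := away_reach tr t s.
  by have := shift_defect_root; lia.
by have := shift_defect_corner ti; have := corner _ _ ti; lia.
Qed.

End Side.

(** If [i] precedes [s] as seen from [t'], the edge from [i] alone contributes enough, as its
    shifted second side lies in the separator of [x]. Otherwise that side becomes [x.2], while the
    edge towards [t'], or the leaf edge if [s = t'], has its second side inside [x.1]. *)
Lemma shift_defect_far t (t' : T) x i s : S x -> away (@edge V T) t i s ->
  sep_le x (lab i s) -> N <= shift_defect t' (sep_inv x) s + sep_order r x.
Proof.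
move=> Sx ti [x1 x2]; have is_ := away_edge ti.
have xE := sep_orderE r_sub (Ssep Sx).
have iE : (lab i s).2 `|` x.2 = x.2 by apply: setUidr.
have [E|[j t'j]] := away_reach tr t' s.
  rewrite /shift_defect -E eqxx mul1n /defect (bigD1 (i : T)) //=.
  rewrite asboolF /=; last exact: away_root.
  rewrite iE.
  have := r_le x.1; have := r_le x.2; rewrite /N in xE *; lia.
have js := away_edge t'j.
rewrite (shift_defect_parent _ t'j) /=.
have [ij|ij] := eqVneq j i.
  have : r ((lab j s).2 `&` x.1) <= sep_order r x.
    by apply: separator_order => //; [exact: Ssep | rewrite ij => v [/x2]].
  lia.
rewrite (bigD1 (i : T)) ?is_ 1?eq_sym //= iE.
have : r ((lab j s).2 `&` x.1) <= r x.1 by apply: r_mono => v [].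
have := r_le x.1; have := r_le x.2; rewrite /N in xE *; lia.
Qed.

Lemma one_side_small t a (t' : T) a' x s :
  S x -> sep_le a x -> sep_le x (sep_inv a') ->
  (forall y, edge t y -> sep_le a (lab t y)) ->
  (forall y, edge t' y -> sep_le a' (lab t' y)) ->
  sep_order r x < r a.1 -> sep_order r x < r a'.1 ->
  (forall u v, away (@edge V T) t u v -> away (@edge V T) t' v u ->
     sep_order r x < sep_order r (lab u v)) ->
  (forall u v, away (@edge V T) t u v ->
     sep_order r (sep_meet (lab u v) x) <= sep_order r x -> nested x (lab u v)) ->
  sep_order r x < weight s -> shift_defect t x s <= defect s ->
  N <= shift_defect t' (sep_inv x) s + sep_order r x.
Proof.
move=> Sx ax xa' at_ at'_ ra ra' onpath nest ws le.
have sx := Ssep Sx.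
have [E|[i ti]] := away_reach tr t s.
  by rewrite E in le; have := shift_defect_root Sx ax at_; lia.
have is_ := away_edge ti.
have corner : sep_order r (sep_meet (lab i s) x) <= sep_order r x.
  by have := shift_defect_corner Sx ti; lia.
have [xi|[xi1 xi2]|ix|[ix1 ix2]] := nest _ _ ti corner.
- exact: shift_defect_far Sx ti xi.
(* Here [a.1] would lie in both sides of [x], against [ra]. *)
- have [a1 _] := lab_away at_ ti.
  have : r a.1 <= sep_order r x; last by lia.
  apply: separator_order => // [|v /a1/xi2 //]; by case: ax.
(* The corner is the label itself, of order too small for an edge between [t] and [t']. So the edge
   also points away from [t'], which puts [a'.1] in both sides of [x]. *)
- have mE : sep_meet (lab i s) x = lab i s.
    case: ix; rewrite /sep_meet; case: (lab i s) => C D /= h1 h2.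
    by rewrite setIidl // setUidl.
  rewrite mE in corner.
  have [t'i|t'i] := away_total tr t' is_; last by have := onpath _ _ ti t'i; lia.
  have [a1 _] := lab_away at'_ t'i.
  have : r a'.1 <= sep_order r x; last by lia.
  apply: separator_order => // [v /a1|]; first by case: ix => h _ /h.
  by case: xa' => _.
(* The parent edge alone would push the weight of this copy down to the order of [x], yet the copy
   keeps the larger weight of [s]. *)
- have : r ((lab i s).2 `&` x.2) <= sep_order r x.
    by apply: separator_order => // v [] // /ix1.
  by move: ws le; rewrite (shift_defect_parent _ ti) /weight /N; lia.
Qed.

End Weights.

(** * Counting heavy vertices and edges *)

Section Level.
Context {V : Type} (r : set V -> nat).
Implicit Types (G H T : sep_graph V).

Definition level_vert T (q : nat) : pred T := fun s => q <= weight r s.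
Definition level_edge T (q : nat) : pred (T * T) :=
  fun p => [&& edge p.1 p.2, level_vert q p.1 & level_vert q p.2].
Definition level (q : nat) T : nat :=
  #|@level_vert T q| + #|@level_edge T q|.

Lemma defect_glue_l G H (v : G) (w : H) c (s : G) :
  defect r (inl s : glue v w c) = defect r s + (s == v) * (r setT - r c.2).
Proof.
rewrite /defect big_sumType /=; congr (_ + _).
have [_|_] := eqVneq s v; last by rewrite big_pred0.
by rewrite mul1n (big_pred1 w).
Qed.

Lemma defect_glue_r G H (v : G) (w : H) c (s : H) :
  defect r (inr s : glue v w c) = defect r s + (s == w) * (r setT - r c.1).
Proof.
rewrite /defect big_sumType /= addnC; congr (_ + _).
have [_|_] := eqVneq s w; last by rewrite big_pred0 // => y; rewrite andbF.
by rewrite mul1n (big_pred1 v) // => y /=; rewrite andbT.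
Qed.

Lemma leq_card_inj (X Y : finType) (A : pred X) (B : pred Y) (f : X -> Y) :
  {in A &, injective f} -> (forall x, A x -> B (f x)) -> #|A| <= #|B|.
Proof.
move=> injf fB; rewrite -(card_in_image injf); apply: subset_leq_card.
by apply/fintype.subsetP => y /fintype.imageP[x Ax ->]; apply: fB.
Qed.

Lemma ltn_card_inj (X Y : finType) (A : pred X) (B : pred Y) (f : X -> Y) y :
  {in A &, injective f} -> (forall x, A x -> B (f x)) ->
  B y -> (forall x, A x -> f x != y) -> #|A| < #|B|.
Proof.
move=> injf fB By ny; rewrite (cardD1 y B) [y \in B]By ltnS.
by apply: leq_card_inj injf _ => x Ax; rewrite !inE ny //; apply: fB.
Qed.

End Level.

(** * Folding the doubled tree back onto the original *)

Section Fold.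
Context {V : Type} (r : set V -> nat).
Variables (T : sep_graph V) (t t' : T) (x : sep V) (q : nat).

(* The leaf edges of the two shifted trees carry (Y, X) and (X, Y), hence can be
   identified. *)
Definition sep_double : sep_graph V :=
  glue (t' : root_shift t' (sep_inv x)) (t : root_shift t x) (sep_inv x).

Definition fold_double (p : sep_double) : T := match p with inl s => s | inr s => s end.

Hypothesis le_weight : forall p : sep_double, weight r p <= weight r (fold_double p).
Hypothesis one_copy : forall s : T,
  ~ (level_vert r q (inl s : sep_double) /\ level_vert r q (inr s : sep_double)).
Hypothesis no_bridge : ~ level_vert r q (inl t' : sep_double).

Let fold_inj : {in @level_vert V r sep_double q &, injective fold_double}.
Proof.
move=> [u|u] [v|v]; rewrite -!topredE /= => hu hv /= E; rewrite E // in hu *.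
  by case: (@one_copy v).
by case: (@one_copy v).
Qed.

Let fold_vert p : @level_vert V r sep_double q p -> @level_vert V r T q (fold_double p).
Proof. by move=> h; apply: leq_trans h (le_weight p). Qed.

Let fold2 (p : sep_double * sep_double) : T * T := (fold_double p.1, fold_double p.2).

Let fold2_inj : {in @level_edge V r sep_double q &, injective fold2}.
Proof.
move=> [u v] [u' v'] /and3P[_ /= hu hv] /and3P[_ /= hu' hv'] [].
by move=> /(fold_inj hu hu') -> /(fold_inj hv hv') ->.
Qed.

Let double_edge (u v : sep_double) : edge u v ->
  level_vert r q u -> level_vert r q v -> edge (fold_double u) (fold_double v).
Proof.
case: u v => [u|u] [v|v] //= => /andP[/eqP E _] h h'; case: no_bridge.
  by rewrite -E.
by rewrite -E.
Qed.

Let fold2_edge p : @level_edge V r sep_double q p -> @level_edge V r T q (fold2 p).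
Proof.
case: p => u v /and3P[/= uv hu hv]; apply/and3P.
by split; [apply: double_edge | apply: fold_vert | apply: fold_vert].
Qed.

(** Folding is injective on heavy vertices by [one_copy], and by [no_bridge] every heavy edge lies
    inside one half, hence folds onto an edge of [T]. *)
Lemma level_double_le : level r q sep_double <= level r q T.
Proof.
apply: leq_add; first exact: leq_card_inj fold_inj fold_vert.
exact: leq_card_inj fold2_inj fold2_edge.
Qed.

Lemma level_double_lt_vert (s : T) : level_vert r q s ->
  ~ level_vert r q (inl s : sep_double) -> ~ level_vert r q (inr s : sep_double) ->
  level r q sep_double < level r q T.
Proof.
move=> hs n1 n2; rewrite /level -addSn; apply: leq_add; last first.
  exact: leq_card_inj fold2_inj fold2_edge.
apply: (ltn_card_inj fold_inj fold_vert hs) => -[u|u] hu; apply/eqP => /= E.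
  by apply: n1; rewrite -E.
by apply: n2; rewrite -E.
Qed.

(** A heavy preimage of [(u, v)] would have to run from the left copy of [u] to the right copy of
    [v], so it would be the bridge. *)
Lemma level_double_lt_edge (u v : T) : edge u v ->
  level_vert r q u -> level_vert r q v ->
  ~ level_vert r q (inl v : sep_double) -> ~ level_vert r q (inr u : sep_double) ->
  level r q sep_double < level r q T.
Proof.
move=> uv hu hv n1 n2; rewrite /level -addnS; apply: leq_add.
  exact: leq_card_inj fold_inj fold_vert.
apply: (@ltn_card_inj _ _ _ _ _ (u, v) fold2_inj fold2_edge); first exact/and3P.
move=> -[a b] /and3P[/= ab ha hb]; apply/eqP => -[Ea Eb].
case: a b ab ha hb Ea Eb => [a|a] [b|b] /= ab ha hb Ea Eb.
- by apply: n1; rewrite -Eb.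
- by case/andP: ab => /eqP E _; apply: no_bridge; rewrite -E.
- by apply: n1; rewrite -Eb.
- by apply: n2; rewrite -Ea.
Qed.

End Fold.

(** * The exchange step *)

Lemma path_switch (T : eqType) (P : pred T) t p : P t -> ~~ P (last t p) ->
  exists u v, [/\ infix [:: u; v] (t :: p), P u & ~~ P v].
Proof.
elim: p t => [|v p IH] t Pt nP; first by rewrite /= Pt in nP.
have [Pv|nv] := boolP (P v).
  have [u [w [/infixP[s1 [s2 E]] Pu Pw]]] := IH v Pv nP.
  exists u, w; split=> //; apply/infixP; exists (t :: s1), s2.
  by rewrite E.
by exists t, v; split=> //; apply/infixP; exists [::], p.
Qed.

Section Exchange.
Context {V : Type} (S : set (sep V)) (r : set V -> nat) (k : nat).
Variable F : set {mset sep V}%mset.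
Hypotheses (S_univ : is_universe S) (r_mono : nondecreasing_setfun r).
Hypothesis r_sub : submodular r.
Hypothesis F_star : forall s, F s ->
  is_star s /\ (forall a, a \in s -> sep_lt_order S r k a).
Hypothesis F_fixed : fixed_under_shifting S r (sep_lt_order S r k) F.

Let R := sep_lt_order S r k.

Let R_inv a : R a -> R (sep_inv a).
Proof.
move=> [Sa oa]; split; last by rewrite sep_order_inv.
by case: S_univ => -[_ h] _ _; apply: h.
Qed.

Variable T : sep_graph V.
Hypotheses (T_tree : is_sep_tree R T) (T_over : tree_over F T).

Let tr : is_tree (@edge V T). Proof. by case: T_tree. Qed.
Let esym : symmetric (@edge V T). Proof. by case: tr. Qed.
Let labR (u v : T) : edge u v -> R (lab u v).
Proof. by case: T_tree => _ h /h[]. Qed.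
Let labS (u v : T) : edge u v -> S (lab u v).
Proof. by case/labR. Qed.
Let labI (u v : T) : edge u v -> lab v u = sep_inv (lab u v).
Proof. by case: T_tree => _ h /h[]. Qed.
Let starT (s u v : T) : edge u s -> edge v s -> u <> v ->
  sep_le (lab u s) (sep_inv (lab v s)).
Proof. by have [/is_star_sigma h _] := F_star (T_over s); apply: h. Qed.

Lemma addable_R a (t : T) : addable F a t -> R a.
Proof. by case/F_star => _; apply; rewrite in_mset1D eqxx. Qed.

Lemma addable_le a (t y : T) : addable F a t -> edge t y -> sep_le a (lab t y).
Proof.
rewrite /addable -sigma_leaf_root => /F_star[/is_star_sigma st _] ty.
have yt : edge y t by rewrite esym.
have := st (inr tt) (inl y); rewrite /= !eqxx => /(_ isT yt) h.
by rewrite (labI yt); apply: h.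
Qed.

(** Addability makes [T] with a leaf [a] at [t] a tame tree whose stars off the leaf are in [F]; the
    minimality of [x] says that it is linked to [a], so closure under shifting applies to the leaf
    edge. *)
Lemma root_shift_over (t : T) a x s :
  addable F a t -> R x -> sep_le a x ->
  (forall y, S y -> sep_le a y -> sep_le y x -> sep_order r x <= sep_order r y) ->
  F (sigma (inl s : @add_leaf V (root_shift t x) t x)).
Proof.
move=> ta Rx ax minx; have Ra := addable_R ta.
have over u : F (sigma (inl u : add_leaf t a)).
  have [->|ut] := pselect (u = t); first by rewrite sigma_leaf_root.
  by rewrite sigma_leaf_other.
pose p : shift (inr tt : add_leaf t a) (inl t) x :=
  exist _ (inl s) (branch_leaf t s tr).
rewrite -(sigma_shift_leaf (p := p) tr ax erefl).
apply: F_fixed => //=.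
- split; first exact: glue_tree no_edge_tree.
  case=> [u|[]] [v|[]] //= uv.
  + by split; [apply: labR | apply: labI].
  + by rewrite sep_invK; split=> //; apply: R_inv.
(* The star at the new leaf may lie outside [F], but it has a single member. *)
- case=> [u|[]]; first by case: (F_star (over u)).
  by apply/is_star_sigma => -[u|[]] [v|[]] //= /andP[/eqP-> _] /andP[/eqP-> _].
- by rewrite !eqxx.
- split=> //; apply/eqP; rewrite eqn_leq; apply/andP.
  have Sa : S a by case: Ra.
  have [[y [Sy ay yx lamE]] min] := lambdaP r Sa ax.
  split; first by rewrite lamE; apply: minx.
  by apply: min; exists x; split=> //; [case: Rx | apply: sep_le_refl].
Qed.

Lemma root_shift_inv (t u v : T) x : edge u v ->
  @lab V (root_shift t x) v u = sep_inv (@lab V (root_shift t x) u v).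
Proof.
move=> uv /=; have [A|A] := away_total tr t uv.
  rewrite (asboolT A) asboolF; last exact: away_asym A.
  by rewrite (labI uv).
rewrite (asboolT A) asboolF; last exact: away_asym A.
by rewrite (labI uv) sep_inv_meet sep_invK.
Qed.

Section Between.
Variables (t t' : T) (a a' x : sep V).
Hypotheses (ta : addable F a t) (ta' : addable F a' t').
Hypotheses (Rx : R x) (ax : sep_le a x) (xa' : sep_le x (sep_inv a')).
Hypothesis minx : forall y, S y -> sep_le a y -> sep_le y (sep_inv a') ->
  sep_order r x <= sep_order r y.

Lemma double_over : tree_over F (sep_double t t' x).
Proof.
case=> s; rewrite ?sigma_glue_l ?sigma_glue_r ?sep_invK.
  apply: root_shift_over ta' (R_inv Rx) (sep_le_invr xa') _ => y Sy ay yx.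
  rewrite sep_order_inv -(sep_order_inv r y); apply: minx.
  - by case: S_univ => -[_ h] _ _; apply: h.
  - by apply: sep_le_trans ax _; apply: sep_le_invr.
  - exact: sep_le_inv.
apply: root_shift_over ta Rx ax _ => y Sy ay yx.
by apply: minx => //; apply: sep_le_trans yx xa'.
Qed.

Lemma double_tree : is_sep_tree R (sep_double t t' x).
Proof.
split; first exact: glue_tree.
move=> u v uv; split.
  by have [_ h] := F_star (double_over v); apply/h/mem_sigma.
case: u v uv => [u|u] [v|v] uv.
- exact: (@root_shift_inv t' u v (sep_inv x) uv).
- by rewrite /= sep_invK.
- by [].
- exact: (@root_shift_inv t u v x uv).
Qed.

End Between.

(** The last two conditions express a lexicographic decrease when the levels are read downwards from
    [r setT]. *)
Lemma not_lean_smaller : ~ lean S r F T ->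
  exists T' q, [/\ is_sep_tree R T', tree_over F T', q <= r setT,
    level r q T' < level r q T &
    forall q', q < q' -> level r q' T' <= level r q' T].
Proof.
move=> nlean.
have [t [t' [a [a' [ta ta' aa' nmin npath]]]]] : exists t t' a a',
  [/\ addable F a t, addable F a' t', sep_le a (sep_inv a'),
      lambda S r a (sep_inv a') < minn (r a.1) (r a'.1) &
      ~ is_min [set n | exists u v : T, on_path_between (@edge V T) t t' u v /\
                         n = sep_order r (lab u v)]
              (lambda S r a (sep_inv a'))].
  apply: contrapT => no; apply: nlean => t t' a a' ta ta' aa'.
  apply: contrapT => /not_orP[h1 h2]; apply: no; exists t, t', a, a'; split=> //.
  by rewrite ltnNge; apply/negP.
have Ra := addable_R ta; have Sa : S a by case: Ra.
have := lambdaP r Sa aa'; set lam := lambda _ _ _ _ in nmin npath *.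
move=> -[[x0 [Sx0 ax0 xa0 E0]] minlam].
have {}minlam y : S y -> sep_le a y -> sep_le y (sep_inv a') -> lam <= sep_order r y.
  by move=> Sy ay ya; apply: minlam; exists y.
pose nestp y : pred (T * T) :=
  fun p => edge p.1 p.2 && `[< nested y (lab p.1 p.2) >].
pose nestc y := #|nestp y|.
have nestc_inv y : nestc (sep_inv y) = nestc y.
  apply: eq_card => p; rewrite -!topredE; congr (_ && _).
  by apply/asboolP/asboolP => /nested_invl; rewrite ?sep_invK.
have nestc_le y : nestc y <= #|{: T * T}| by apply: max_card.
(* Maximality of [nestc] is obtained by minimising its complement in the number of all pairs. *)
have [|x [[Sx ax xa ox] maxx]] := @ex_argmin _
    (fun y => [/\ S y, sep_le a y, sep_le y (sep_inv a') & sep_order r y <= lam])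
    (fun y => #|{: T * T}| - nestc y).
  by exists x0; split=> //; rewrite -E0.
have {}maxx y : S y -> sep_le a y -> sep_le y (sep_inv a') ->
    sep_order r y <= lam -> nestc y <= nestc x.
  move=> Sy ay ya oy; have := maxx y (And4 Sy ay ya oy).
  by have := nestc_le y; have := nestc_le x; lia.
have {}ox : sep_order r x = lam.
  by apply/eqP; rewrite eqn_leq ox minlam.
(* The corner stays nested with everything [y] is nested with, because tree labels are pairwise
   nested, and gains [(u, v)] itself. *)
have grow (y : sep V) (u v : T) : edge u v -> ~ nested y (lab u v) ->
    nestc y < nestc (sep_meet (lab u v) y).
  move=> uv ny; rewrite /nestc; apply: (@ltn_card_inj _ _ (nestp y) (nestp _) id (u, v)) => //.
  - move=> p /andP[pe /asboolP yp]; apply/andP; split=> //; apply/asboolP.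
    exact: nested_meet (lab_nested tr labI starT uv pe).
  - apply/andP; split=> //; apply/asboolP.
    by constructor 1; apply: sep_meet_lel.
  - move=> p /andP[_ /asboolP yp]; apply: contra_notN ny => /eqP E.
    by move: yp; rewrite E.
have at_ y := addable_le (y := y) ta; have at'_ y := addable_le (y := y) ta'.
have S_inv y : S y -> S (sep_inv y) by case: S_univ => -[_ h] _ _; apply: h.
have S_meet y z : S y -> S z -> S (sep_meet y z) by case: S_univ => _ h _; apply: h.
have a'x := sep_le_invr xa; have oix := sep_order_inv r x.
have between u v : away (@edge V T) t u v ->
    [/\ S (sep_meet (lab u v) x), sep_le a (sep_meet (lab u v) x)
      & sep_le (sep_meet (lab u v) x) (sep_inv a')].
  move=> tu; split.
  - by apply: S_meet => //; apply: labS; apply: away_edge tu.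
  - by apply: sep_le_meet => //; apply: lab_away tu.
  - exact: sep_le_trans (sep_meet_ler _ _) xa.
have between' u v : away (@edge V T) t' u v ->
    [/\ S (sep_inv (sep_meet (lab u v) (sep_inv x))),
        sep_le a (sep_inv (sep_meet (lab u v) (sep_inv x)))
      & sep_le (sep_inv (sep_meet (lab u v) (sep_inv x))) (sep_inv a')].
  move=> tu; split.
  - apply/S_inv/S_meet; last exact: S_inv.
    by apply: labS; apply: away_edge tu.
  - apply: sep_le_invr; apply: sep_le_trans (sep_meet_ler _ _) _.
    exact: sep_le_inv.
  - by apply: sep_le_inv; apply: sep_le_meet => //; apply: lab_away tu.
(* A crossing edge with so small a corner would make the corner a better choice than [x]. *)
have nest u v : away (@edge V T) t u v ->
    sep_order r (sep_meet (lab u v) x) <= sep_order r x -> nested x (lab u v).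
  move=> tu; rewrite ox => om; apply: contrapT => nn.
  have [b1 b2 b3] := between _ _ tu.
  by have := grow _ _ _ (away_edge tu) nn; have := maxx _ b1 b2 b3 om; lia.
have nest' u v : away (@edge V T) t' u v ->
    sep_order r (sep_meet (lab u v) (sep_inv x)) <= sep_order r (sep_inv x) ->
    nested (sep_inv x) (lab u v).
  move=> tu; rewrite oix ox -sep_order_inv => om; apply: contrapT => nn.
  have [b1 b2 b3] := between' _ _ tu.
  have := grow _ _ _ (away_edge tu) nn; have := maxx _ b1 b2 b3 om.
  by rewrite !nestc_inv; lia.
have pathlam u v : on_path_between (@edge V T) t t' u v ->
    lam <= sep_order r (lab u v).
  move=> /(on_path_away tr)[tu t'v]; have uv := away_edge tu.
  apply: minlam; [exact: labS | exact: lab_away tu |].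
  by apply: sep_le_invr; rewrite -labI //; apply: lab_away t'v.
(* An edge of order [lam] on the path would attain the minimum that [npath] excludes. *)
have {npath} onpath u v : on_path_between (@edge V T) t t' u v ->
    lam < sep_order r (lab u v).
  move=> uv; rewrite ltn_neqAle pathlam // andbT; apply/eqP => E.
  apply: npath; split; first by exists u, v.
  by move=> m [u' [v' [uv' ->]]]; apply: pathlam.
have path1 u v : away (@edge V T) t u v -> away (@edge V T) t' v u ->
    sep_order r x < sep_order r (lab u v).
  by move=> tu t'v; rewrite ox; apply/onpath/away_on_path.
have path2 u v : away (@edge V T) t' u v -> away (@edge V T) t v u ->
    sep_order r (sep_inv x) < sep_order r (lab u v).
  move=> tu t'v; rewrite oix -(sep_order_inv r (lab u v)) -labI; last exact: away_edge tu.
  exact: path1.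
move: nmin; rewrite leq_min => /andP[ra ra'].
have minx y : S y -> sep_le a y -> sep_le y (sep_inv a') ->
  sep_order r x <= sep_order r y by rewrite ox; apply: minlam.
have Rx : R x.
  split=> //; case: Ra => _; apply: leq_ltn_trans; apply: minx => //.
  exact: sep_le_refl.
pose D := sep_double t t' x; pose w (s : T) := weight r s.
pose w1 s := weight r (inl s : D); pose w2 s := weight r (inr s : D).
have w1E s : w1 s = r setT - shift_defect r t' (sep_inv x) s.
  by rewrite /w1 /weight defect_glue_l.
have w2E s : w2 s = r setT - shift_defect r t x s.
  by rewrite /w2 /weight defect_glue_r.
have Sx' := S_inv x Sx.
have ge1 s : defect r s <= shift_defect r t' (sep_inv x) s.
  apply: (@shift_defect_ge _ _ S _ _ _ _ _ _ _ _ _ a') => //.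
  - by rewrite oix ox ltnW.
  - move=> u v tu; have [b1 b2 b3] := between' _ _ tu.
    by rewrite oix -(sep_order_inv r (sep_meet _ _)); apply: minx.
have ge2 s : defect r s <= shift_defect r t x s.
  apply: (@shift_defect_ge _ _ S _ _ _ _ _ _ _ _ _ a) => //.
  - by rewrite ox ltnW.
  - by move=> u v tu; have [b1 b2 b3] := between _ _ tu; apply: minx.
have le1 s : w1 s <= w s by rewrite w1E leq_sub2l.
have le2 s : w2 s <= w s by rewrite w2E leq_sub2l.
have small1 s : lam < w s -> w s <= w2 s -> w1 s <= lam.
  rewrite w1E w2E /w => ws h.
  have : r setT <= shift_defect r t' (sep_inv x) s + sep_order r x; last by lia.
  apply: (@one_side_small _ r S _ _ _ _ _ _ _ _ t a _ a') => //; rewrite ?ox //.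
  by move: ws h; rewrite /weight; lia.
have small2 s : lam < w s -> w s <= w1 s -> w2 s <= lam.
  rewrite w1E w2E /w => ws h.
  have : r setT <= shift_defect r t (sep_inv (sep_inv x)) s + sep_order r (sep_inv x).
    apply: (@one_side_small _ r S _ _ _ _ _ _ _ _ t' a' _ a) => //; rewrite ?oix ?ox //.
    + exact: sep_le_inv.
    + by move: ws h; rewrite /weight; lia.
  by rewrite sep_invK oix; lia.
have wt : lam < w t by apply: leq_trans ra _; apply: (@star_le_weight _ r S).
have wt' : lam < w t' by apply: leq_trans ra' _; apply: (@star_le_weight _ r S).
have lt1 : w1 t' < w t'.
  have : defect r t' + r a'.1 <=
      shift_defect r t' (sep_inv x) t' + sep_order r (sep_inv x).
    exact: (@shift_defect_root _ r S).
  by move: wt'; rewrite w1E /w /weight oix; lia.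
have lt2 : w2 t < w t.
  have : defect r t + r a.1 <= shift_defect r t x t + sep_order r x.
    exact: (@shift_defect_root _ r S).
  by move: wt; rewrite w2E /w /weight; lia.
pose broken s := [&& lam < w s, w1 s < w s & w2 s < w s].
have unbroken s : lam < w s -> ~~ broken s -> w s <= w1 s \/ w s <= w2 s.
  by rewrite /broken => -> /=; rewrite negb_and -!leqNgt => /orP.
(* [q] is the largest weight of a broken vertex; without broken vertices it is the first value above
   [lam]. *)
have [q [lamq qN brq strict]] : exists q, [/\ lam < q, q <= r setT,
    forall s, broken s -> w s <= q &
    (exists s, broken s /\ w s = q) \/ (q = lam.+1 /\ forall s, ~~ broken s)].
  have [ex|no] := pselect (exists s, broken s).
    have [s [bs smax]] := @ex_argmin _ broken (fun s => r setT - w s) ex.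
    exists (w s); split; [by case/and3P: bs | exact: leq_subr | | by left; exists s].
    move=> s' /smax; have := leq_subr (defect r s) (r setT).
    by have := leq_subr (defect r s') (r setT); rewrite /w /weight; lia.
  exists lam.+1; split=> //.
  - exact: leq_trans wt (leq_subr _ _).
  - by move=> s bs; case: no; exists s.
  - by right; split=> // s; apply/negP => bs; apply: no; exists s.
have le_weight (p : D) : weight r p <= weight r (fold_double p) by case: p.
(* Two copies of weight at least [q'] exclude that [s] is broken, so one copy keeps the full weight
   and the other drops to at most [lam]. *)
have one_copy q' : q <= q' -> forall s : T,
    ~ (level_vert r q' (inl s : D) /\ level_vert r q' (inr s : D)).
  move=> qq' s [h1 h2]; rewrite /level_vert -/(w1 s) -/(w2 s) in h1 h2.
  have ws : lam < w s by have := le1 s; lia.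
  have [bs|/(unbroken _ ws)[h|h]] := boolP (broken s).
  - by have := brq s bs; case/and3P: bs; lia.
  - by have := small2 s ws h; lia.
  - by have := small1 s ws h; lia.
have no_bridge q' : q <= q' -> ~ level_vert r q' (inl t' : D).
  move=> qq' h; rewrite /level_vert -/(w1 t') in h.
  have [bs|/(unbroken _ wt')[h'|h']] := boolP (broken t').
  - by have := brq _ bs; case/and3P: bs; lia.
  - by lia.
  - by have := small1 _ wt' h'; lia.
exists D, q; split=> //.
- exact: (double_tree ta ta' Rx ax xa minx).
- exact: (double_over ta ta' Rx ax xa minx).
- case: strict => [[s [/and3P[_ b1 b2] ws]]|[qE nb]].
    apply: (level_double_lt_vert le_weight (one_copy _ _) (no_bridge _ _) (s := s)) => //.
    + by rewrite /level_vert -ws.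
    + by rewrite /level_vert -/(w1 s) -ws; lia.
    + by rewrite /level_vert -/(w2 s) -ws; lia.
  have [_ _ _ conn _] := tr; have /connectP[p0 pp0 lp0] := conn t t'.
  case/shortenP: pp0 lp0 => p pp up _ lp.
  (* With no broken vertex, [t] keeps its weight in the first copy because it loses some in the
     second, and [t'] behaves the other way round. Hence the weight in the first copy falls to [lam]
     or below across some edge of the path. *)
  have w1t : lam < w1 t.
    by case: (unbroken _ wt (nb t)) => h; [apply: leq_trans wt h | lia].
  have w1t' : ~~ (lam < w1 t').
    case: (unbroken _ wt' (nb t')) => h; first by lia.
    by rewrite -leqNgt; apply: small1.
  rewrite lp in w1t'.
  have [u [v [inf w1u w1v]]] := path_switch (P := fun s => lam < w1 s) w1t w1t'.
  have uvp : on_path_between (@edge V T) t t' u v by exists p.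
  have [tu _] := on_path_away tr uvp; have uv := away_edge tu.
  have vu : edge v u by rewrite esym.
  (* The order of the path edge exceeds [lam] and bounds the weights of both its ends from below, so
     [T] counts this edge at level [lam.+1]. *)
  have wv : lam < w v by apply: leq_trans (onpath _ _ uvp) _; apply: (@order_le_weight _ r S).
  have wu : lam < w u.
    apply: leq_trans (onpath _ _ uvp) _; rewrite -sep_order_inv -labI //.
    exact: (@order_le_weight _ r S).
  apply: (level_double_lt_edge le_weight (one_copy _ _) (no_bridge _ _) uv) => //;
    rewrite qE //.
  + exact/negP.
  + rewrite /level_vert -/(w2 u).
    by case: (unbroken _ wu (nb u)) => h; [have := small2 _ wu h | have := small1 _ wu h]; lia.
- move=> q' qq'; apply: level_double_le => //.
  + by apply: one_copy; lia.
  + by apply: no_bridge; lia.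
Qed.

End Exchange.

Theorem theorem4p1 (V : Type) (S : set (sep V)) (r : set V -> nat) (k : nat)
    (F : set {mset sep V}%mset) :
  is_universe S ->
  nondecreasing_setfun r ->
  submodular r ->
  (forall s, F s ->
     is_star s /\ (forall a, a \in s -> sep_lt_order S r k a)) ->
  fixed_under_shifting S r (sep_lt_order S r k) F ->
  (exists T : sep_graph V,
     is_sep_tree (sep_lt_order S r k) T /\ tree_over F T) ->
  exists T : sep_graph V,
    [/\ is_sep_tree (sep_lt_order S r k) T, tree_over F T & lean S r F T].
Proof.
move=> univ mono sub star fixed exT.
(* Coordinate [i] stands for level [r setT - i], so the highest levels are compared first;
   [(r setT).+1] coordinates reach down to level 0. *)
have [T [[trT ovT] minT]] :=
  ex_lexmin (fun i => level r (r setT - i)) (r setT).+1 exT.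
exists T; split=> //; apply: contrapT => nl.
have [T' [q [trT' ovT' qN lt le]]] :=
  not_lean_smaller univ mono sub star fixed trT ovT nl.
have := minT T' (conj trT' ovT') (r setT - q); rewrite subKn // ltnS leq_subr.
move=> /(_ isT) h; have : level r q T <= level r q T'; last by lia.
by apply: h => j jq; apply: le; lia.
Qed.
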